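(* Let $p$ be a prime and let $G_1$ and $G_2$ be two finite abelian $p$-groups of the same order. Then $G_1\cong G_2$ if and only if $\psi(G_1)=\psi(G_2)$.
   Context: For a finite group $G$, $\psi(G)=\sum_{a\in G}o(a)$, where $o(a)$ denotes the order of the element $a\in G$. *)

(* Defs.v *)
From mathcomp Require Import all_boot all_fingroup all_solvable.

Set Implicit Arguments.
Unset Strict Implicit.
Unset Printing Implicit Defensive.

Definition psi (gT : finGroupType) (G : {group gT}) : nat :=
  \sum_(a in G) #[a]%g.

(* Main.v *)
Require Import Defs.
From mathcomp Require Import all_boot all_fingroup all_solvable.

(** The theorem holds because, for an abelian [p]-group, [psi] encodes the
  orders of all the layers ['Ohm_k(G)] as the digits of one number.

  Let [p ^ w k = #|'Ohm_k(G)|]; since [G] is abelian, this counts the elements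
  of order dividing [p ^ k].  If [#|G|] divides [p ^ M], then summation
  by parts gives ([psi_Ohm])
    [psi G + (p - 1) * \sum_(k < M) p ^ (k + w k) = p ^ M * #|G|].
  So, for groups of the same order, [psi] determines the sum on the left.  As
  [w] is nondecreasing, the exponents [k + w k] are strictly increasing: the
  sum is a base [p] expansion with digits 0 and 1, and the positions of its
  nonzero digits, hence the [w k], can be read off ([sum_expn_inj]).

  It remains that the [w k] determine an abelian [p]-group.  In a cyclic
  decomposition, the number of factors of order greater than [p ^ k] is
  [w k.+1 - w k] ([count_logn_dprod_cycle]); these numbers determine the
  multiset of the orders of the factors ([perm_eq_count_gtn]), that is, the
  type of the group ([card_Ohm_isog]). *)

Set Implicit Arguments.
Unset Strict Implicit.
Unset Printing Implicit Defensive.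

Import GroupScope.

Local Open Scope nat_scope.

Lemma sum_expn_ltn p (e : nat -> nat) m :
    1 < p -> (forall k, e k < e k.+1) ->
  \sum_(k < m) p ^ e k < p ^ e m.
Proof.
move=> p_gt1 e_incr; elim: m => [|m IHm].
  by rewrite big_ord0 expn_gt0 (ltnW p_gt1).
rewrite big_ord_recr /=; apply: (@leq_trans (p ^ (e m).+1)).
  by rewrite expnS -addSn (leq_trans (leq_add IHm (leqnn _))) // addnn -mul2n
    leq_mul2r p_gt1 orbT.
by rewrite leq_exp2l.
Qed.

(** Uniqueness of the base [p] expansion, for digits 0 and 1: the top power
  dominates the sum of the lower ones, so the top exponents agree and can be
  cancelled. *)
Lemma sum_expn_inj p (e f : nat -> nat) m :
    1 < p -> (forall k, e k < e k.+1) -> (forall k, f k < f k.+1) ->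
    \sum_(k < m) p ^ e k = \sum_(k < m) p ^ f k ->
  forall k, k < m -> e k = f k.
Proof.
move=> p_gt1.
(* All n.+1 terms of the first sum add up to less than p ^ (g n).+1, which the
   top term of the second one already reaches. *)
have sum_lt (g h : nat -> nat) n : (forall k, g k < g k.+1) -> g n < h n ->
    \sum_(k < n.+1) p ^ g k < \sum_(k < n.+1) p ^ h k.
  move=> g_incr lt_gh; rewrite !big_ord_recr /=.
  apply: (@leq_trans (p ^ (g n).+1)).
    have := sum_expn_ltn n p_gt1 g_incr; rewrite -(ltn_add2r (p ^ g n)).
    move=> /leq_trans-> //.
    by rewrite addnn -mul2n expnS leq_mul2r p_gt1 orbT.
  by rewrite (leq_trans _ (leq_addl _ _)) // leq_exp2l.
move=> e_incr f_incr; elim: m => // m IHm eq_sum.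
have eq_m: e m = f m.
  case: (ltngtP (e m) (f m)) => // lt_m.
    by have := sum_lt e f m e_incr lt_m; rewrite eq_sum ltnn.
  by have := sum_lt f e m f_incr lt_m; rewrite eq_sum ltnn.
move=> k; rewrite ltnS leq_eqVlt => /predU1P[-> // | /IHm]; apply.
by move: eq_sum; rewrite !big_ord_recr /= eq_m => /addIn.
Qed.

(** This is the geometric sum of [(p - 1) * p ^ k] for [j <= k < M]; the
  condition is a factor so that [psi_Ohm] can exchange sums. *)
Lemma expn_add_sum p j M :
    0 < p -> j <= M ->
  p ^ j + p.-1 * \sum_(k < M) (j <= k) * p ^ k = p ^ M.
Proof.
move=> p_gt0; elim: M => [|M IHM] le_jM.
  by move: le_jM; rewrite leqn0 => /eqP->; rewrite big_ord0 muln0 addn0.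
move: le_jM; rewrite leq_eqVlt ltnS => /predU1P[-> | le_jM].
  rewrite big1 ?muln0 ?addn0 // => k _.
  by rewrite leqNgt ltn_ord.
rewrite big_ord_recr /= le_jM mul1n mulnDr addnA IHM //.
by rewrite -mulSn prednK // expnS.
Qed.

Lemma psi_isog (gT1 gT2 : finGroupType) (G1 : {group gT1}) (G2 : {group gT2}) :
  G1 \isog G2 -> psi G1 = psi G2.
Proof.
case/isogP=> f inj_f im_f; rewrite /psi -im_f morphimEdom big_imset /=.
  by apply: eq_bigr => a Ga; rewrite order_injm.
exact/injmP.
Qed.

(** Summation by parts: an element of order [p ^ j] contributes
  [p ^ j = p ^ M - (p - 1) * \sum_(j <= k < M) p ^ k] to [psi G], and it lies
  in ['Ohm_k(G)] exactly when [j <= k]. *)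
Lemma psi_Ohm (p M : nat) (gT : finGroupType) (G : {group gT}) :
    prime p -> abelian G -> p.-group G -> logn p #|G| <= M ->
  psi G + p.-1 * \sum_(k < M) p ^ k * #|'Ohm_k(G)| = p ^ M * #|G|.
Proof.
move=> p_pr cGG pG leM.
have p_gt1 := prime_gt1 p_pr.
have cardOhm k : #|'Ohm_k(G)| = \sum_(a in G) (#[a] %| p ^ k).
  have cOO: abelian 'Ohm_k(G) by apply: abelianS cGG; apply: Ohm_sub.
  rewrite (OhmEabelian pG cOO) -sum1_card big_mkcond [RHS]big_mkcond /=.
  apply: eq_bigr => a _; rewrite !inE order_dvdn.
  by case: (a \in G); case: (a ^+ _ == 1)%g.
under eq_bigr => k _ do rewrite cardOhm big_distrr /=.
rewrite exchange_big big_distrr /psi -big_split /=.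
rewrite mulnC -sum_nat_const; apply: eq_bigr => a Ga.
have /p_natP[j oa]: p.-elt a by apply: mem_p_elt pG Ga.
have le_jM: j <= M.
  by apply: leq_trans leM; rewrite -pfactor_dvdn // -oa order_dvdG.
rewrite oa -[RHS](expn_add_sum (ltnW p_gt1) le_jM); congr (_ + _ * _).
by apply: eq_bigr => k _; rewrite mulnC dvdn_Pexp2l.
Qed.

(** The multiplicity of [n.+1] is the number of entries above [n] minus the
  number of entries above [n.+1].  Positivity is needed because no such count
  detects the entries equal to 0. *)
Lemma perm_eq_count_gtn (s t : seq nat) :
    all (ltn 0) s -> all (ltn 0) t ->
    (forall n, count (ltn n) s = count (ltn n) t) ->
  perm_eq s t.
Proof.
move=> s_gt0 t_gt0 eq_count.
have count_diff (r : seq nat) n :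
    count_mem n.+1 r = count (ltn n) r - count (ltn n.+1) r.
  suffices ->: count (ltn n) r = count_mem n.+1 r + count (ltn n.+1) r.
    by rewrite addnK.
  by elim: r => //= x r ->; rewrite addnACA; congr (_ + _); case: (ltngtP n.+1 x).
have count_0 (r : seq nat) : all (ltn 0) r -> count_mem 0 r = 0.
  move=> r_gt0; apply/count_memPn; apply: contraL r_gt0 => r0.
  by apply/allPn; exists 0.
apply/allP=> -[|n] _ /=; first by rewrite !count_0.
by rewrite !count_diff !eq_count.
Qed.

(** The index of ['Ohm_n(G)] in ['Ohm_n.+1(G)] is [p ^ r], where [r] is the
  number of cyclic factors of order greater than [p ^ n]: each of them, and no
  other, contributes a factor [p].  So the orders of the layers give the
  exponents of the type, and these suffice since a type is sorted. *)
Lemma card_Ohm_isog (p : nat) (gT1 gT2 : finGroupType)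
    (G1 : {group gT1}) (G2 : {group gT2}) :
    abelian G1 -> abelian G2 -> p.-group G1 -> p.-group G2 ->
    (forall n, #|'Ohm_n(G1)| = #|'Ohm_n(G2)|) ->
  G1 \isog G2.
Proof.
move=> cG1 cG2 pG1 pG2 eqO; rewrite eq_abelian_type_isog //.
(* An abelian type is a sorted list of nontrivial powers of p, so it suffices
   to compare the multisets of exponents, and the Ohm series counts those. *)
have logs (gT : finGroupType) (G : {group gT}) : abelian G -> p.-group G ->
    [/\ map (expn p) (map (logn p) (abelian_type G)) = abelian_type G,
        all (ltn 0) (map (logn p) (abelian_type G))
      & forall n, count (ltn n) (map (logn p) (abelian_type G))
                  = logn p (#|'Ohm_n.+1(G)| %/ #|'Ohm_n(G)|)].
  move=> cGG pG; have [b defG def_t] := abelian_structure cGG.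
  have p_t m : m \in abelian_type G -> p ^ logn p m = m /\ 0 < logn p m.
    move=> t_m; have := allP (abelian_type_gt1 G) m t_m => /= m_gt1.
    suffices def_m: p ^ logn p m = m.
      split=> //; rewrite lt0n; apply: contraTneq m_gt1 => log0.
      by rewrite -def_m log0.
    move: t_m; rewrite -def_t => /mapP[x b_x ->{m m_gt1}].
    have Gx: x \in G.
      rewrite -(bigdprodWY defG) mem_gen // bigcup_seq.
      by apply/bigcupP; exists x; rewrite ?cycle_id.
    by rewrite -p_part part_pnat_id //; apply: mem_p_elt pG Gx.
  split=> [||n].
  - rewrite -map_comp -[RHS]map_id.
    by apply/eq_in_map=> m /p_t[].
  - by rewrite all_map; apply/allP=> m /p_t[].
  - rewrite count_map -def_t count_map divgS ?Ohm_leq //.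
    by rewrite -(count_logn_dprod_cycle p n defG).
have [def1 gt1 count1] := logs _ _ cG1 pG1.
have [def2 gt2 count2] := logs _ _ cG2 pG2.
apply/eqP/(@sorted_eq _ geq); try exact: abelian_type_sorted.
- by move=> y x z le_yx le_zy; apply: leq_trans le_zy le_yx.
- by move=> x y /=; rewrite andbC => /anti_leq.
rewrite -def1 -def2 perm_map // perm_eq_count_gtn // => n.
by rewrite count1 count2 !eqO.
Qed.

Theorem corollary5 (p : nat) (gT1 gT2 : finGroupType)
    (G1 : {group gT1}) (G2 : {group gT2}) :
  prime p ->
  abelian G1 -> abelian G2 ->
  (p.-group G1)%g -> (p.-group G2)%g ->
  #|G1| = #|G2| ->
  ((G1 \isog G2)%g <-> psi G1 = psi G2).
Proof.
move=> p_pr cG1 cG2 pG1 pG2 eqG; split=> [|eq_psi]; first exact: psi_isog.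
have p_gt1 := prime_gt1 p_pr.
apply: (card_Ohm_isog cG1 cG2 pG1 pG2) => n.
(* psi_Ohm requires that #|G1| divide p ^ M; sum_expn_inj reads off only the
   layers below M, whence n.+1. *)
pose M := maxn n.+1 (logn p #|G1|).
have leM1: logn p #|G1| <= M by apply: leq_maxr.
have leM2: logn p #|G2| <= M by rewrite -eqG.
have cardO (gT : finGroupType) (G : {group gT}) k :
    p.-group G -> #|'Ohm_k(G)| = p ^ logn p #|'Ohm_k(G)|.
  by move=> pG; rewrite -card_pgroup // (pgroupS (Ohm_sub _ _)).
have incr (gT : finGroupType) (G : {group gT}) k :
    k + logn p #|'Ohm_k(G)| < k.+1 + logn p #|'Ohm_k.+1(G)|.
  by rewrite ltnS leq_add2l dvdn_leq_log ?cardG_gt0 // cardSg ?Ohm_leq.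
have := psi_Ohm p_pr cG1 pG1 leM1; rewrite eqG -(psi_Ohm p_pr cG2 pG2 leM2).
rewrite eq_psi => /addnI/eqP.
rewrite eqn_pmul2l ?ltn_predRL // => /eqP.
have expand (gT : finGroupType) (G : {group gT}) : p.-group G ->
    \sum_(k < M) p ^ k * #|'Ohm_k(G)|
    = \sum_(k < M) p ^ (k + logn p #|'Ohm_k(G)|).
  by move=> pG; apply: eq_bigr => k _; rewrite expnD -cardO.
rewrite !expand // => /(sum_expn_inj p_gt1 (incr _ G1) (incr _ G2)).
by move=> /(_ n (leq_maxl _ _)) /addnI eq_log; rewrite cardO // eq_log -cardO.
Qed.
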